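(* Let $G=(V,E)$ be a graph with $n$ nodes, and let $\mathcal{S}=a_1:\ldots:a_\ell$ be a hierarchy with integers $a_i\ge 2$ and $k=\prod_{i=1}^{\ell}a_i$. Online recursive multi-section along $\mathcal{S}$ coupled with Fennel or LDG as the scoring rule needs $O(n+k)$ memory.
   Context: One-pass streaming model: nodes of $G$ arrive one at a time together with their neighborhood $N(u)$ and must be permanently assigned to a block on arrival. A hierarchy $\mathcal{S}=a_1:\ldots:a_\ell$ defines a tree of blocks: layer $\ell$ has $a_\ell$ blocks; each block of layer $i>1$ has $a_{i-1}$ sub-blocks in layer $i-1$; layer $1$ contains the $k$ final blocks. Online recursive multi-section: when node $u$ arrives, for $i=\ell,\ldots,1$ it chooses among the $a_i$ candidate blocks of layer $i$ (all top-layer blocks if $i=\ell$, otherwise the sub-blocks of the block chosen at layer $i+1$) the one maximizing a score, and assigns $u$ to it; weights of all blocks at all layers are maintained. Scores for a candidate block $W$ in layer $i$: Fennel uses $|W\cap N(u)|-\alpha_i\gamma|W|^{\gamma-1}$ (with constants $\alpha_i$, $\gamma$); LDG uses $|W\cap N(u)|\,(1-|W|/L_i)$, where $L_i$ is the capacity of blocks at layer $i$. Both rules require knowing, for already streamed nodes, which blocks they were assigned to, and the current block weights. *)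

(* Defs.v *)
From HB Require Import structures.
From mathcomp Require Import all_boot all_order all_algebra.
From mathcomp Require Import reals exp.
Set Implicit Arguments.
Unset Strict Implicit.
Unset Printing Implicit Defensive.
Import Order.TTheory GRing.Theory Num.Theory.
Local Open Scope nat_scope.

(** * The hierarchy and its tree of blocks *)

(* A hierarchy a_1 : ... : a_ell is the sequence [:: a_1; ...; a_ell]; layers
   are numbered from 1, so that [branching a i] is a_i for 1 <= i <= ell. *)
Definition branching (a : seq nat) (i : nat) : nat := nth 0 a i.-1.

Definition num_blocks (a : seq nat) : nat := \prod_(b <- a) b.

(* A block is named by the path that leads to it from the top of the tree: the
   block [:: c_ell; ...; c_i] lies in layer i, its sub-blocks are
   [:: c_ell; ...; c_i; c] with c < a_(i-1), and the final blocks are the paths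
   of size ell. The empty path (the whole node set) is not a block. *)
Definition is_block (a w : seq nat) : bool :=
  (0 < size w <= size a) &&
  all2 (fun c b => c < b) w (take (size w) (rev a)).

(** * Scoring rules *)

Variant rule := Fennel | LDG.

Record params (R : realType) := Params {
  alpha : nat -> R;   (* Fennel: alpha_i *)
  gamma : R;          (* Fennel: gamma *)
  cap : nat -> R      (* LDG: L_i *)
}.

(* [o] stands for the overlap |W :&: N(u)| and [w] for the weight |W|. *)
Definition score (R : realType) (rl : rule) (prm : params R) (i o w : nat) : R :=
  match rl with
  | Fennel => o%:R - alpha prm i * gamma prm * powR w%:R (gamma prm - 1)
  | LDG => o%:R * (1 - w%:R / cap prm i)
  end%R.

(** * Online recursive multi-section *)

Section MultiSection.
Variable n : nat.

(* [asg v] is the final block of v (hence determines its block in every layer),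
   or None if v has not been streamed yet. *)
Definition assignment := 'I_n -> option (seq nat).

Definition unassigned : assignment := fun=> None.

Definition assign (asg : assignment) (u : 'I_n) (p : seq nat) : assignment :=
  fun v => if v == u then Some p else asg v.

Definition members (asg : assignment) (w : seq nat) : {set 'I_n} :=
  [set v | if asg v is Some p then prefix w p else false].

Variables (R : realType) (rl : rule) (prm : params R).
Variables (e : rel 'I_n) (a : seq nat).

Definition block_score (asg : assignment) (u : 'I_n) (i : nat) (w : seq nat) : R :=
  score rl prm i #|members asg w :&: [set v | e u v]| #|members asg w|.

(* [descend asg u i w p]: with i layers left, and w the block chosen for u so
   far, the algorithm may end up in the final block p. Ties between candidates
   of maximal score may be broken in any way. *)
Inductive descend (asg : assignment) (u : 'I_n) : nat -> seq nat -> seq nat -> Prop :=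
| DescendEnd p : descend asg u 0 p p
| DescendLayer i w c p :
    c < branching a i.+1 ->
    (forall c', c' < branching a i.+1 ->
       (block_score asg u i.+1 (rcons w c') <= block_score asg u i.+1 (rcons w c))%R) ->
    descend asg u i (rcons w c) p ->
    descend asg u i.+1 w p.

Definition multisection_choice (asg : assignment) (u : 'I_n) (p : seq nat) : Prop :=
  descend asg u (size a) [::] p.

(* A one-pass stream: every node once, in any order, together with a listing of
   its neighborhood, in any order. *)
Definition is_stream (stream : seq ('I_n * seq 'I_n)) : Prop :=
  perm_eq [seq x.1 | x <- stream] (enum 'I_n) /\
  (forall x, x \in stream -> uniq x.2 /\ x.2 =i [pred v | e x.1 v]).

End MultiSection.

Arguments unassigned {n}.

(** * The machine model *)

(* A random access machine programmed in a while language. Its memory is a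
   sequence of words, all addressable. It also has a read-only input (the
   hierarchy, the parameters of the scoring rule, and the node that has just
   arrived with its neighborhood) and a write-only output. Real numbers can only
   be used inside tests: they are never stored, so that words are the only thing
   a program can remember. *)

Inductive aexp :=
| ALit (c : nat)
| ALoad (x : aexp)      (* the memory word at address x *)
| AAdd (x y : aexp)
| ASub (x y : aexp)     (* truncated *)
| AMul (x y : aexp)
| ADiv (x y : aexp)
| AMod (x y : aexp)
| AEll                  (* the number of layers *)
| ABranch (x : aexp)    (* a_x *)
| ANode                 (* the node that has just arrived *)
| ADeg                  (* the size of its neighborhood *)
| ANbr (x : aexp).      (* its neighbor number x, from 0 *)

Inductive rexp :=
| RNat (x : aexp)
| RAlpha (x : aexp)
| RGamma
| RCap (x : aexp)
| RAdd (x y : rexp)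
| ROpp (x : rexp)
| RMul (x y : rexp)
| RInv (x : rexp)
| RPow (x y : rexp).

Inductive bexp :=
| BEq (x y : aexp)
| BLe (x y : aexp)
| BRLe (x y : rexp)
| BNot (x : bexp)
| BAnd (x y : bexp).

Inductive cmd :=
| Skip
| Store (x y : aexp)    (* memory[x] := y *)
| Emit (x : aexp)
| Seq (c d : cmd)
| If (b : bexp) (c d : cmd)
| While (b : bexp) (c : cmd).

(* [setup] runs once, before the stream; [arrival] runs at each arrival. *)
Record program := Program { setup : cmd; arrival : cmd }.

Record input (R : realType) := Input {
  in_hierarchy : seq nat;
  in_params : params R;
  in_node : nat;
  in_nbrs : seq nat
}.

Section Semantics.
Variables (R : realType) (inp : input R).

Fixpoint aeval (m : seq nat) (x : aexp) : nat :=
  match x with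
  | ALit c => c
  | ALoad x => nth 0 m (aeval m x)
  | AAdd x y => aeval m x + aeval m y
  | ASub x y => aeval m x - aeval m y
  | AMul x y => aeval m x * aeval m y
  | ADiv x y => aeval m x %/ aeval m y
  | AMod x y => aeval m x %% aeval m y
  | AEll => size (in_hierarchy inp)
  | ABranch x => branching (in_hierarchy inp) (aeval m x)
  | ANode => in_node inp
  | ADeg => size (in_nbrs inp)
  | ANbr x => nth 0 (in_nbrs inp) (aeval m x)
  end.

Fixpoint reval (m : seq nat) (x : rexp) : R :=
  match x with
  | RNat x => (aeval m x)%:R
  | RAlpha x => alpha (in_params inp) (aeval m x)
  | RGamma => gamma (in_params inp)
  | RCap x => cap (in_params inp) (aeval m x)
  | RAdd x y => reval m x + reval m y
  | ROpp x => - reval m x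
  | RMul x y => reval m x * reval m y
  | RInv x => (reval m x)^-1
  | RPow x y => powR (reval m x) (reval m y)
  end%R.

Fixpoint beval (m : seq nat) (b : bexp) : bool :=
  match b with
  | BEq x y => aeval m x == aeval m y
  | BLe x y => aeval m x <= aeval m y
  | BRLe x y => (reval m x <= reval m y)%R
  | BNot b => ~~ beval m b
  | BAnd b b' => beval m b && beval m b'
  end.

(* [exec B c m m' out]: started on memory m, the command c terminates with
   memory m' and emits out. The number of words is fixed, and a word only holds
   numbers below B: there is no execution in which the program stores outside of
   the memory, or stores a number that does not fit in a word. *)
Inductive exec (B : nat) : cmd -> seq nat -> seq nat -> seq nat -> Prop :=
| ExecSkip m : exec B Skip m m [::]
| ExecStore x y m :
    aeval m x < size m -> aeval m y < B ->
    exec B (Store x y) m (set_nth 0 m (aeval m x) (aeval m y)) [::]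
| ExecEmit x m : exec B (Emit x) m m [:: aeval m x]
| ExecSeq c d m m' m'' o o' :
    exec B c m m' o -> exec B d m' m'' o' -> exec B (Seq c d) m m'' (o ++ o')
| ExecIf b c d m m' o :
    exec B (if beval m b then c else d) m m' o -> exec B (If b c d) m m' o
| ExecWhileEnd b c m : ~~ beval m b -> exec B (While b c) m m [::]
| ExecWhileLoop b c m m' m'' o o' :
    beval m b -> exec B c m m' o -> exec B (While b c) m' m'' o' ->
    exec B (While b c) m m'' (o ++ o').

End Semantics.

(** * Implementing online recursive multi-section on the machine *)

Section Implementation.
Variables (R : realType) (rl : rule) (prm : params R) (n : nat).
Variables (e : rel 'I_n) (a : seq nat).
Variables (P : program) (addr : seq nat -> nat) (B : nat).

(* The weight of each block w, in each layer, is kept at the address addr w. *)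
Definition keeps_weights (asg : assignment n) (m : seq nat) : Prop :=
  forall w, is_block a w -> addr w < size m /\ nth 0 m (addr w) = #|members asg w|.

Definition arrival_input (u : 'I_n) (N : seq 'I_n) : input R :=
  Input a prm (val u) (map val N).

Definition setup_input : input R := Input a prm 0 [::].

(* At each arrival, the program must emit the path of a final block that online
   recursive multi-section may choose. *)
Fixpoint processes (asg : assignment n) (m : seq nat)
    (stream : seq ('I_n * seq 'I_n)) : Prop :=
  if stream is (u, N) :: stream' then
    exists m' p,
      [/\ exec (arrival_input u N) B (arrival P) m m' p,
          multisection_choice rl prm e a asg u p,
          keeps_weights (assign asg u p) m' &
          processes (assign asg u p) m' stream']
  else True.

Definition implements (s : nat) (stream : seq ('I_n * seq 'I_n)) : Prop :=
  exists m,
    [/\ exec setup_input B (setup P) (nseq s 0) m [::],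
        keeps_weights unassigned m &
        processes unassigned m stream].

End Implementation.

(* Besides the s words of memory, we also charge for the read-only input: the
   hierarchy, the parameters alpha_i, gamma, L_i, and the current node with its
   neighborhood. *)
Definition total_memory (n : nat) (a : seq nat) (s : nat)
    (stream : seq ('I_n * seq 'I_n)) : nat :=
  s + (3 * size a).+1 + \max_(x <- stream) (size x.2).+1.

(* Main.v *)
Require Import Defs.
From HB Require Import structures.
From mathcomp Require Import all_boot all_order all_algebra.
From mathcomp Require Import reals exp.
From mathcomp Require Import zify.
Set Implicit Arguments.
Unset Strict Implicit.
Unset Printing Implicit Defensive.
Import Order.TTheory GRing.Theory Num.Theory.
Local Open Scope nat_scope.

(* A block is numbered by its path read as a number in the mixed radix given by
   the hierarchy, with a leading digit 1. The numbers of all blocks in all layers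
   are distinct and below 2k, and dividing the number of a final block by
   a_1 ... a_(i-1) gives the number of its ancestor in layer i. Hence one word
   per node (the number of its final block) and one word per block (its weight)
   suffice: overlaps are recomputed by scanning the neighborhood for each
   candidate, with a constant number of registers. *)

(** * Numbering the blocks *)

Section Code.
Variable a : seq nat.

Definition code (w : seq nat) : nat :=
  foldl (fun x cb => x * cb.2 + cb.1) 1 (zip w (rev a)).

(** Unlike [is_block], this admits the empty path, where the descent and the inductions on [rcons]
    start. *)
Definition is_path (w : seq nat) : bool :=
  (size w <= size a) && all2 (fun c b => c < b) w (take (size w) (rev a)).

(* The number of final blocks below a block with i layers left under it. *)
Definition leaves (i : nat) : nat := \prod_(b <- take i a) b.

Lemma is_blockE w : is_block a w = (0 < size w) && is_path w.
Proof. by rewrite /is_block /is_path andbA. Qed.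

Lemma leaves0 : leaves 0 = 1.
Proof. by rewrite /leaves take0 big_nil. Qed.

Lemma leavesS i : i < size a -> leaves i.+1 = leaves i * nth 0 a i.
Proof. by move=> ia; rewrite /leaves (take_nth 0) // -cats1 big_cat big_seq1. Qed.

Lemma leaves_size : leaves (size a) = num_blocks a.
Proof. by rewrite /leaves take_size. Qed.

Lemma zip_rcons_nth (T : Type) (w : seq T) c s :
  size w < size s -> zip (rcons w c) s = rcons (zip w s) (c, nth 0 s (size w)).
Proof. by elim: w s => [|x w IH] [|y s] //=; [case: s | move/IH->]. Qed.

Lemma code_nil : code [::] = 1.
Proof. by rewrite /code; case: (rev a). Qed.

Lemma code_rcons w c i : size w + i.+1 = size a ->
  code (rcons w c) = code w * nth 0 a i + c.
Proof.
move=> wi; rewrite /code zip_rcons_nth ?size_rev; last by lia.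
rewrite -cats1 foldl_cat /= nth_rev; last by lia.
by congr (_ * nth _ _ _ + _); lia.
Qed.

Lemma is_path_nil : is_path [::].
Proof. by rewrite /is_path take0. Qed.

Lemma is_path_rcons w c i : size w + i.+1 = size a ->
  is_path (rcons w c) = is_path w && (c < nth 0 a i).
Proof.
move=> wi; rewrite /is_path size_rcons.
rewrite (take_nth 0) ?size_rev; last by lia.
rewrite !all2E !size_rcons nth_rev; last by lia.
rewrite eqSS; have sz : size w = size (take (size w) (rev a)).
  by rewrite size_take size_rev; case: ltnP; lia.
rewrite -sz eqxx /= zip_rcons // all_rcons /=.
have -> : size a - (size w).+1 = i by lia.
have -> : size w < size a by lia.
have -> : size w <= size a by lia.
by rewrite /= andbC.
Qed.

Lemma is_path_size w : is_path w -> size w <= size a.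
Proof. by case/andP. Qed.

Hypothesis a_ge2 : all (leq 2) a.

Lemma nth_ge2 i : i < size a -> 2 <= nth 0 a i.
Proof. by move=> ia; apply: (allP a_ge2); apply: mem_nth. Qed.

Lemma leaves_gt0 i : i <= size a -> 0 < leaves i.
Proof.
elim: i => [|i IH] ia; first by rewrite leaves0.
by rewrite leavesS // muln_gt0 IH ?(ltnW ia) // (leq_trans _ (nth_ge2 ia)).
Qed.

(** Every added layer contributes a factor at least 2. This doubling is what keeps the code ranges
    of different layers apart. *)
Lemma leaves_ltn i j : i < j -> j <= size a -> 2 * leaves i <= leaves j.
Proof.
elim: j => // j IH ij ja; have b2 := nth_ge2 ja.
rewrite leavesS //; case: (ltnP i j) => [lt_ij | le_ji].
  by have := IH lt_ij (ltnW ja); nia.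
have -> : i = j by lia.
by nia.
Qed.

Lemma leaves_leq i j : i <= j -> j <= size a -> leaves i <= leaves j.
Proof.
by rewrite leq_eqVlt => /predU1P[-> // | ij] /(leaves_ltn ij); lia.
Qed.

Lemma ltn_leaves i : i <= size a -> i < leaves i.
Proof.
elim: i => [|i IH] ia; first by rewrite leaves0.
by have := leaves_ltn (ltnSn i) ia; have := IH (ltnW ia); lia.
Qed.

Lemma nth_leq_num_blocks i : i < size a -> nth 0 a i <= num_blocks a.
Proof.
move=> ia; rewrite -leaves_size.
have := leaves_leq ia (leqnn _); rewrite leavesS //.
by have := leaves_gt0 (ltnW ia); nia.
Qed.

(* The leading digit 1 of a code puts the blocks of a layer with K blocks in
   [K, 2K), and K at least doubles from one layer to the next. *)
Lemma code_bounds w i : is_path w -> size w + i = size a ->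
  num_blocks a <= code w * leaves i /\
  (code w).+1 * leaves i <= 2 * num_blocks a.
Proof.
elim/last_ind: w i => [|w c IH] i.
  by move=> _ ia; rewrite -[i]add0n ia leaves_size code_nil; split; lia.
rewrite size_rcons => pw sz; have wi : size w + i.+1 = size a by lia.
move: pw; rewrite (is_path_rcons _ wi) => /andP[pw cb].
have [] := IH _ pw wi; rewrite (code_rcons _ wi) leavesS; last by lia.
by split; nia.
Qed.

Lemma code_ltn w : is_path w -> code w < 2 * num_blocks a.
Proof.
move=> pw; have wa := is_path_size pw.
have [_] := code_bounds pw (subnKC wa).
by have := leaves_gt0 (leq_subr (size w) (size a)); nia.
Qed.

Lemma code_gt0 w : is_path w -> 0 < code w.
Proof.
move=> pw; have [+ _] := code_bounds pw (subnKC (is_path_size pw)).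
by have := leaves_gt0 (leqnn (size a)); rewrite leaves_size; case: (code w) => //; lia.
Qed.

(** If [w] were strictly deeper than [v], the lower bound on [code w] and the upper bound on
    [code v] would contradict the doubling of [leaves]: the code ranges of two layers are
    disjoint. *)
Lemma code_leq_size w v :
  is_path w -> is_path v -> code w = code v -> size w <= size v.
Proof.
move=> pw pv eq_wv; rewrite leqNgt; apply/negP => vw.
have wa := is_path_size pw; have va := is_path_size pv.
have [lo _] := code_bounds pw (subnKC wa).
have [_ hi] := code_bounds pv (subnKC va).
have := @leaves_ltn (size a - size w) (size a - size v).
have := leaves_gt0 (leq_subr (size w) (size a)).
move: lo hi; rewrite eq_wv => lo hi ? lv.
have := lv ltac:(lia) (leq_subr _ _).
by nia.
Qed.

(** Equal codes force equal depths; then Euclidean division by the branching factor recovers the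
    last digit as remainder and the code of the parent as quotient. *)
Lemma code_inj : {in is_path &, injective code}.
Proof.
move=> w v pw pv eq_wv.
have sz : size w = size v.
  by apply/eqP; rewrite eqn_leq !code_leq_size.
elim/last_ind: w v sz pw pv eq_wv => [|w c IH] v; first by case: v.
case/lastP: v => [|v d]; rewrite !size_rcons // => -[sz] pw.
have := is_path_size pw; rewrite size_rcons => wa; move: pw.
have wi : size w + (size a - (size w).+1).+1 = size a by lia.
have vi : size v + (size a - (size w).+1).+1 = size a by lia.
rewrite /in_mem /= (is_path_rcons _ wi) (is_path_rcons _ vi).
move=> /andP[pw cb] /andP[pv db]; rewrite (code_rcons _ wi) (code_rcons _ vi).
set b := nth _ _ _ in cb db *.
move=> E; have b_gt0 : 0 < b by apply: leq_ltn_trans cb.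
have Ewv : code w = code v.
  by have := congr1 (divn^~ b) E; rewrite !divnMDl // !divn_small // !addn0.
by rewrite (IH v) //; congr rcons; move: E; rewrite Ewv; lia.
Qed.

Lemma is_path_take t w : is_path w -> is_path (take t w).
Proof.
elim/last_ind: w => [|w c IH] pw; first by [].
have := is_path_size pw; rewrite size_rcons => wa.
have wi : size w + (size a - (size w).+1).+1 = size a by lia.
case: (ltnP (size w) t) => wt; first by rewrite take_oversize // size_rcons.
by rewrite -cats1 takel_cat // IH //; move: pw; rewrite (is_path_rcons _ wi) => /andP[].
Qed.

(** Dividing by [leaves i] amounts to dividing by the lowest [i] branching factors in turn, and each
    division drops the last digit of the path. *)
Lemma code_div_leaves p i : is_path p -> size p = size a -> i <= size a ->
  code p %/ leaves i = code (take (size a - i) p).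
Proof.
move=> pp sp; elim: i => [|i IH] ia.
  by rewrite leaves0 divn1 subn0 -sp take_size.
rewrite leavesS // divnMA IH ?(ltnW ia) //.
have -> : size a - i = (size a - i.+1).+1 by lia.
have pt := is_path_take (size a - i.+1).+1 pp.
move: pt; rewrite (take_nth 0); last by lia.
set w := take _ p; have wi : size w + i.+1 = size a.
  by rewrite size_take sp; case: ltnP; lia.
rewrite (is_path_rcons _ wi) => /andP[_ cb]; rewrite (code_rcons _ wi).
by rewrite divnMDl ?divn_small ?addn0 //; apply: leq_ltn_trans cb.
Qed.

(** Justifies the membership test of [overlap_loop]: one division decides whether a final block lies
    below a candidate. *)
Lemma prefix_code w p i : is_path w -> size w + i = size a ->
  is_path p -> size p = size a -> (code p %/ leaves i == code w) = prefix w p.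
Proof.
move=> pw wi pp sp; rewrite code_div_leaves //; last by lia.
rewrite prefixE; have -> : size a - i = size w by lia.
by apply/eqP/eqP => [/code_inj-> // | -> //]; apply: is_path_take.
Qed.

End Code.

(** * The program *)

Definition reg (r : nat) : aexp := ALoad (ALit r).

Local Notation rI := 0 (only parsing).  (* layer *)
Local Notation rW := 1 (only parsing).  (* code of the block chosen so far *)
Local Notation rQ := 2 (only parsing).  (* number of final blocks below a block *)
Local Notation rC := 3 (only parsing).  (* candidate *)
Local Notation rJ := 4 (only parsing).  (* position in the neighborhood *)
Local Notation rO := 5 (only parsing).  (* overlap of the candidate *)
Local Notation rB := 6 (only parsing).  (* best candidate so far *)
Local Notation rBO := 7 (only parsing).  (* overlap of the best candidate so far *)

Definition set_reg (r : nat) (x : aexp) : cmd := Store (ALit r) x.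
Definition incr (r : nat) : cmd := set_reg r (AAdd (reg r) (ALit 1)).
Definition lt_exp (x y : aexp) : bexp := BLe (AAdd x (ALit 1)) y.

(* After the 8 registers, block weights (at even offsets) and the codes of the
   final blocks of the nodes (at odd offsets) are interleaved, so that the
   program needs to know neither n nor k; the word of a node that has not
   arrived yet is 0, which is no code. *)
Definition weight_addr (x : aexp) : aexp := AAdd (ALit 8) (AMul (ALit 2) x).
Definition node_addr (x : aexp) : aexp :=
  AAdd (ALit 8) (AAdd (AMul (ALit 2) x) (ALit 1)).

Definition child_code (c : aexp) : aexp :=
  AAdd (AMul (reg rW) (ABranch (reg rI))) c.

Definition score_exp (rl : rule) (i o w : aexp) : rexp :=
  match rl with
  | Fennel => RAdd (RNat o) (ROpp (RMul (RMul (RAlpha i) RGamma)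
      (RPow (RNat w) (RAdd RGamma (ROpp (RNat (ALit 1)))))))
  | LDG => RMul (RNat o)
      (RAdd (RNat (ALit 1)) (ROpp (RMul (RNat w) (RInv (RCap i)))))
  end.

Definition child_score (rl : rule) (c o : aexp) : rexp :=
  score_exp rl (reg rI) o (ALoad (weight_addr (child_code c))).

Definition leaves_loop : cmd :=
  While (lt_exp (reg rI) AEll)
    (Seq (incr rI) (set_reg rQ (AMul (reg rQ) (ABranch (reg rI))))).

Definition overlap_loop : cmd :=
  While (lt_exp (reg rJ) ADeg)
    (Seq (If (BEq (ADiv (ALoad (node_addr (ANbr (reg rJ)))) (reg rQ))
                  (child_code (reg rC)))
             (incr rO) Skip)
         (incr rJ)).

(** Reals cannot be stored, so the best candidate is kept as an index with its overlap, and its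
    score is recomputed at each comparison. Ties go to the later candidate. *)
Definition candidate_loop (rl : rule) : cmd :=
  While (lt_exp (reg rC) (ABranch (reg rI)))
    (Seq (set_reg rO (ALit 0))
    (Seq (set_reg rJ (ALit 0))
    (Seq overlap_loop
    (Seq (If (BAnd (BLe (ALit 1) (reg rC))
                   (BNot (BRLe (child_score rl (reg rB) (reg rBO))
                               (child_score rl (reg rC) (reg rO)))))
             Skip
             (Seq (set_reg rB (reg rC)) (set_reg rBO (reg rO))))
         (incr rC))))).

Definition layer_loop (rl : rule) : cmd :=
  While (BLe (ALit 1) (reg rI))
    (Seq (set_reg rQ (ADiv (reg rQ) (ABranch (reg rI))))
    (Seq (set_reg rC (ALit 0))
    (Seq (candidate_loop rl)
    (Seq (set_reg rW (child_code (reg rB)))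
    (Seq (Store (weight_addr (reg rW))
                (AAdd (ALoad (weight_addr (reg rW))) (ALit 1)))
    (Seq (Emit (reg rB))
         (set_reg rI (ASub (reg rI) (ALit 1))))))))).

(** After [leaves_loop], [rI] holds the number of layers and [rQ] holds k, the state from which the
    descent starts; [rW] starts at 1, the code of the empty path. *)
Definition arrival_cmd (rl : rule) : cmd :=
  Seq (set_reg rI (ALit 0))
  (Seq (set_reg rQ (ALit 1))
  (Seq leaves_loop
  (Seq (set_reg rW (ALit 1))
  (Seq (layer_loop rl)
       (Store (node_addr ANode) (reg rW)))))).

Definition multisection_program (rl : rule) : program :=
  Program Skip (arrival_cmd rl).

(** * Weakest preconditions *)

Section WeakestPrecondition.
Variables (R : realType) (inp : input R) (B : nat).
Implicit Types (Post : seq nat -> seq nat -> Prop) (m : seq nat).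

(** The existential asserts a terminating run in which every store is in range, so each loop is
    handled by induction on its remaining iterations. *)
Definition wp (c : cmd) Post m : Prop :=
  exists m' o, exec inp B c m m' o /\ Post m' o.

Lemma wp_skip Post m : Post m [::] -> wp Skip Post m.
Proof. by exists m, [::]; split=> //; constructor. Qed.

Lemma wp_store x y Post m :
  aeval inp m x < size m -> aeval inp m y < B ->
  Post (set_nth 0 m (aeval inp m x) (aeval inp m y)) [::] ->
  wp (Store x y) Post m.
Proof. by move=> ? ? ?; eexists; exists [::]; split; first by constructor. Qed.

Lemma wp_emit x Post m : Post m [:: aeval inp m x] -> wp (Emit x) Post m.
Proof. by eexists; eexists; split; first by constructor. Qed.

Lemma wp_seq c d Post m :
  wp c (fun m' o => wp d (fun m'' o' => Post m'' (o ++ o')) m') m ->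
  wp (Seq c d) Post m.
Proof.
by move=> [m1 [o1 [E1 [m2 [o2 [E2 H]]]]]]; exists m2, (o1 ++ o2); split=> //;
  apply: ExecSeq E1 E2.
Qed.

Lemma wp_if b c d Post m :
  wp (if beval inp m b then c else d) Post m -> wp (If b c d) Post m.
Proof. by move=> [m' [o [E H]]]; exists m', o; split=> //; constructor. Qed.

Lemma wp_while_end b c Post m :
  ~~ beval inp m b -> Post m [::] -> wp (While b c) Post m.
Proof. by exists m, [::]; split=> //; constructor. Qed.

Lemma wp_while_step b c Post m :
  beval inp m b ->
  wp c (fun m' o => wp (While b c) (fun m'' o' => Post m'' (o ++ o')) m') m ->
  wp (While b c) Post m.
Proof.
by move=> bm [m1 [o1 [E1 [m2 [o2 [E2 H]]]]]]; exists m2, (o1 ++ o2); split=> //;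
  apply: ExecWhileLoop bm E1 E2.
Qed.

End WeakestPrecondition.

(** * Loops *)

Local Notation memory i w q c j o b bo d := [:: i, w, q, c, j, o, b, bo & d].

Section Loops.
Variables (R : realType) (rl : rule) (prm : params R) (a : seq nat).
Variables (u : nat) (N : seq nat) (B : nat).
Implicit Types (Post : seq nat -> seq nat -> Prop) (d : seq nat).

Local Notation inp := (Input a prm u N).
Local Notation wp := (wp inp B).

Hypothesis a_ge2 : all (leq 2) a.
Hypothesis B_large : 2 * num_blocks a + size N < B.

Let k_gt : size a < num_blocks a.
Proof. by rewrite -leaves_size; apply: ltn_leaves. Qed.

Lemma wp_leaves_loop Post i w c j o b bo d : i <= size a ->
  Post (memory (size a) w (num_blocks a) c j o b bo d) [::] ->
  wp leaves_loop Post (memory i w (leaves a i) c j o b bo d).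
Proof.
move=> ia HP; have [t def_t] : {t | t = size a - i} by eexists.
elim: t i ia def_t => [|t IH] i ia def_t.
  have -> : i = size a by lia.
  by rewrite leaves_size; apply: wp_while_end => //=; lia.
have lt_ia : i < size a by lia.
have le_k := leaves_leq a_ge2 lt_ia (leqnn _); rewrite leaves_size in le_k.
apply: wp_while_step => /=; first by lia.
apply: wp_seq; apply: wp_store => //=; first by lia.
rewrite addn1 /set_reg; apply: wp_store => //=; rewrite /branching /= -leavesS //.
  by lia.
by apply: IH => //; lia.
Qed.

(** [d] is the memory after the 8 registers, so the word read is that of node [v]; the quotient is
    the code of an ancestor of its final block. *)
Definition hits d (q x : nat) : pred nat := fun v => nth 0 d (2 * v + 1) %/ q == x.

Lemma wp_overlap_loop Post i w q c j b bo d : j <= size N ->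
  let h := hits d q (w * branching a i + c) in
  Post (memory i w q c (size N) (count h N) b bo d) [::] ->
  wp overlap_loop Post (memory i w q c j (count h (take j N)) b bo d).
Proof.
move=> jN h HP; have [t def_t] : {t | t = size N - j} by eexists.
elim: t j jN def_t => [|t IH] j jN def_t.
  have -> : j = size N by lia.
  by rewrite take_size; apply: wp_while_end => //=; lia.
have lt_jN : j < size N by lia.
have le_count := count_size h (take j N); rewrite size_take lt_jN in le_count.
apply: wp_while_step => /=; first by lia.
have count_S : count h (take j.+1 N) = count h (take j N) + h (nth 0 N j).
  by rewrite (take_nth 0) // -cats1 count_cat /= addn0.
have {}IH : wp overlap_loop Post (memory i w q c (j + 1)
    (count h (take j N) + h (nth 0 N j)) b bo d).
  by rewrite -count_S addn1; apply: IH => //; lia.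
apply: wp_seq; apply: wp_if.
have -> : beval inp (memory i w q c j (count h (take j N)) b bo d)
   (BEq (ADiv (ALoad (node_addr (ANbr (reg rJ)))) (reg rQ)) (child_code (reg rC)))
   = h (nth 0 N j) by [].
case: (h _) IH => IH.
  apply: wp_store => //=; first by lia.
  by apply: wp_store => //=; lia.
apply: wp_skip; rewrite addn0 in IH.
by apply: wp_store => //=; lia.
Qed.

Definition code_score (i q w : nat) d (c : nat) : R :=
  let x := w * branching a i + c in
  score rl prm i (count (hits d q x) N) (nth 0 d (2 * x)).

(** The guard [0 < c] is there because [rB] and [rBO] hold stale values until the first candidate
    has been examined. *)
Definition best_upto (i q w : nat) d (c b bo : nat) : Prop :=
  0 < c ->
  [/\ b < c, bo = count (hits d q (w * branching a i + b)) N &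
      forall c', c' < c -> (code_score i q w d c' <= code_score i q w d b)%R].

Lemma wp_candidate_loop Post i w q c j o b bo d :
  c <= branching a i -> branching a i < B ->
  (forall j o b bo, best_upto i q w d (branching a i) b bo ->
     Post (memory i w q (branching a i) j o b bo d) [::]) ->
  best_upto i q w d c b bo ->
  wp (candidate_loop rl) Post (memory i w q c j o b bo d).
Proof.
move=> cb bB HP; have [t def_t] : {t | t = branching a i - c} by eexists.
elim: t c j o b bo cb def_t => [|t IH] c j o b bo cb def_t best.
  have Ec : c = branching a i by lia.
  by rewrite Ec in best *; apply: wp_while_end => /=; [lia | apply: HP].
apply: wp_while_step => /=; first by lia.
apply: wp_seq; apply: wp_store => //=; first by lia.
apply: wp_seq; apply: wp_store => //=; first by lia.
apply: wp_seq.
have := @wp_overlap_loop _ i w q c 0 b bo d (leq0n _); rewrite take0 /=; apply.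
have le_count (h : pred nat) : count h N < B by have := count_size h N; lia.
apply: wp_seq; apply: wp_if.
set m := memory _ _ _ _ _ _ _ _ _.
have -> : beval inp m (BAnd (BLe (ALit 1) (reg rC))
   (BNot (BRLe (child_score rl (reg rB) (reg rBO)) (child_score rl (reg rC) (reg rO)))))
  = (0 < c) && ~~ (score rl prm i bo (nth 0 d (2 * (w * branching a i + b)))
                  <= code_score i q w d c)%R.
  by rewrite /code_score /score /m; case: (rl).
case: ifPn => [/andP[c_gt0 lt_s] | le_s].
  have [lt_bc Ebo ge_b] := best c_gt0; rewrite Ebo -/(code_score i q w d b) in lt_s.
  apply: wp_skip; apply: wp_store => //=; first by lia.
  rewrite addn1; apply: IH; [lia | lia | move=> _; split=> //; first exact: ltnW].
  move=> c'; rewrite ltnS leq_eqVlt => /predU1P[-> | /ge_b //].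
  by apply: ltW; rewrite ltNge.
apply: wp_seq; apply: wp_store => //=; first by lia.
apply: wp_store => //=; apply: wp_store => //=; first by lia.
rewrite addn1; apply: IH; [lia | lia | move=> _; split=> // c'].
rewrite ltnS leq_eqVlt => /predU1P[-> // | lt_c'].
have c_gt0 : 0 < c by lia.
have [lt_bc Ebo ge_b] := best c_gt0.
move: le_s; rewrite c_gt0 negbK /= Ebo; apply: le_trans; exact: ge_b.
Qed.

End Loops.

(** * Correctness *)

Lemma prefix_rcons (T : eqType) (x w : seq T) c :
  prefix x (rcons w c) = (x == rcons w c) || prefix x w.
Proof.
apply/idP/orP => [|[/eqP-> | /prefixP[s ->]]].
- case/prefixP=> s; case/lastP: s => [|s y]; first by rewrite cats0 => ->; left.
  rewrite -rcons_cat => /rcons_inj[-> _]; right; exact: prefix_prefix.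
- exact: prefix_refl.
- by rewrite rcons_cat prefix_prefix.
Qed.

Lemma prefix_rcons_self (T : eqType) (w : seq T) c : prefix (rcons w c) w = false.
Proof. by apply/negP => /size_prefix; rewrite size_rcons ltnn. Qed.

(** * Correctness of a single arrival *)

Section Arrival.
Variables (R : realType) (rl : rule) (prm : params R) (n : nat).
Variables (e : rel 'I_n) (a : seq nat).
Variables (u : 'I_n) (N : seq 'I_n) (B : nat) (asg : assignment n).

Hypothesis a_ge2 : all (leq 2) a.
Hypothesis N_uniq : uniq N.
Hypothesis N_nbrs : N =i [pred v | e u v].
Hypothesis B_large : 2 * num_blocks a + n < B.

Definition assigns_final (g : assignment n) : Prop :=
  forall v p, g v = Some p -> is_path a p /\ size p = size a.

(* The node being placed is already counted in the blocks on the path w. *)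
Definition stores (g : assignment n) (w d : seq nat) : Prop :=
  [/\ size d = 4 * num_blocks a + 2 * n,
      forall v : 'I_n, nth 0 d (2 * v + 1) = oapp (code a) 0 (g v) &
      forall x, is_block a x ->
        nth 0 d (2 * code a x) = #|members g x| + prefix x w].

Hypothesis asg_final : assigns_final asg.
Hypothesis u_fresh : asg u = None.

Let size_N : size N <= n.
Proof. by rewrite -(card_uniqP N_uniq) -[X in _ <= X]card_ord max_card. Qed.

Let B_nbrs : 2 * num_blocks a + size (map val N) < B.
Proof. by rewrite size_map; apply: leq_ltn_trans B_large; rewrite leq_add2l. Qed.

Local Notation inp := (arrival_input prm a u N).
Local Notation wp := (wp inp B).

(** The neighbor list has no repetition, so counting gives a cardinality. A node not yet streamed
    has word 0, whose quotient 0 is never a code, so it is not counted. *)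
Lemma count_hits d w x i : stores asg w d -> is_path a x -> size x + i = size a ->
  count (hits d (leaves a i) (code a x)) (map val N)
    = #|members asg x :&: [set v | e u v]|.
Proof.
move=> [_ d_nodes _] px xi; rewrite count_map -size_filter.
rewrite -(card_uniqP (filter_uniq _ N_uniq)); apply: eq_card => v.
rewrite mem_filter N_nbrs !inE; congr (_ && _).
rewrite /hits /= d_nodes; case E: (asg v) => [p|] /=.
  by have [pp sp] := asg_final E; rewrite prefix_code.
by rewrite div0n; apply/negbTE; rewrite eq_sym -lt0n; exact: (code_gt0 a_ge2 px).
Qed.

(** Extending the path adds just one prefix, the new block. Parity protects the node words from the
    increment, and injectivity of [code] protects the other weights. *)
Lemma stores_rcons d w c : stores asg w d -> is_block a (rcons w c) ->
  let y := 2 * code a (rcons w c) in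
  stores asg (rcons w c) (set_nth 0 d y (nth 0 d y + 1)).
Proof.
move=> [d_size d_nodes d_blocks] blk y.
have pw : is_path a (rcons w c) by move: blk; rewrite is_blockE => /andP[].
have y_lt := code_ltn a_ge2 pw.
split=> [|v|x xblk].
- by rewrite size_set_nth -d_size; apply/maxn_idPr; lia.
- rewrite nth_set_nth /=; case: eqP => // E; exfalso.
  by move: E; rewrite /y; lia.
rewrite nth_set_nth /= prefix_rcons eqn_mul2l /=.
have -> : (code a x == code a (rcons w c)) = (x == rcons w c).
  apply/eqP/eqP => [|-> //]; apply: (code_inj a_ge2) => //.
  by move: xblk; rewrite is_blockE => /andP[].
case: eqP => [->|_] /=; last by rewrite d_blocks.
by rewrite /y d_blocks // prefix_rcons_self addn0.
Qed.

(** Induction on the layers left; digits are emitted from the top down, so [out] is the rest of the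
    path below [w]. *)
Lemma wp_layer_loop Post i w c j o b bo d :
  is_path a w -> size w + i = size a -> stores asg w d ->
  (forall q c j o b bo d out,
     descend rl prm e a asg u i w (w ++ out) ->
     is_path a (w ++ out) -> size (w ++ out) = size a -> stores asg (w ++ out) d ->
     Post (memory 0 (code a (w ++ out)) q c j o b bo d) out) ->
  wp (layer_loop rl) Post (memory i (code a w) (leaves a i) c j o b bo d).
Proof.
elim: i w c j o b bo d Post => [|i IH] w c j o b bo d Post pw wi std HP.
  apply: wp_while_end => //.
  have := HP (leaves a 0) c j o b bo d [::].
  by rewrite cats0; apply=> //; [constructor | rewrite -wi addn0].
have ia : i < size a by lia.
have b2 := nth_ge2 a_ge2 ia.
have bk := nth_leq_num_blocks a_ge2 ia.
have lk : leaves a i <= num_blocks a.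
  by rewrite -leaves_size; apply: leaves_leq => //; exact: ltnW.
have ik : i < num_blocks a.
  exact: leq_trans (ltn_leaves a_ge2 (ltnW ia)) lk.
have Eq : leaves a i.+1 %/ branching a i.+1 = leaves a i.
  by rewrite leavesS // /branching /= mulnK // (leq_trans _ b2).
apply: wp_while_step => //.
apply: wp_seq; apply: wp_store => //=; rewrite ?Eq; first by lia.
apply: wp_seq; apply: wp_store => //=; first by lia.
apply: wp_seq; apply: wp_candidate_loop => //; first by rewrite /branching /=; lia.
move=> {c j o b bo} j o c bo /(_ (ltn_trans (ltn0Sn _) b2))[lt_c _ best].
have pwc c' : c' < branching a i.+1 -> is_path a (rcons w c').
  by move=> lt_c'; rewrite (is_path_rcons _ wi) pw.
have wci c' : size (rcons w c') + i = size a by rewrite size_rcons; lia.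
have Ecode c' : code a w * branching a i.+1 + c' = code a (rcons w c').
  by rewrite (code_rcons _ wi).
have Escore c' : c' < branching a i.+1 ->
    code_score rl prm a (map val N) i.+1 (leaves a i) (code a w) d c'
    = block_score rl prm e asg u i.+1 (rcons w c').
  move=> lt_c'; rewrite /code_score Ecode /block_score.
  rewrite (count_hits std (pwc _ lt_c') (wci _)); congr (score _ _ _ _ _).
  (* A child of [w] is no prefix of [w], so the increments already made along the path leave its
     weight as it was before the arrival. *)
  have [_ _ ->] := std; first by rewrite prefix_rcons_self addn0.
  by rewrite is_blockE size_rcons pwc.
have blk : is_block a (rcons w c) by rewrite is_blockE size_rcons pwc.
have code_lt := code_ltn a_ge2 (pwc _ lt_c).
apply: wp_seq; apply: wp_store => //=; rewrite Ecode; first by lia.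
have [d_size _ d_blocks] := std.
apply: wp_seq; apply: wp_store.
- by rewrite /= d_size; lia.
- rewrite /= -[nth _ _ _]/(nth 0 d (2 * code a (rcons w c))) d_blocks //.
  have : #|members asg (rcons w c)| <= n by rewrite -[X in _ <= X]card_ord max_card.
  by rewrite prefix_rcons_self; lia.
set m := set_nth _ _ _ _.
have {m}-> : m = memory i.+1 (code a (rcons w c)) (leaves a i)
    (branching a i.+1) j o c bo (set_nth 0 d (2 * code a (rcons w c))
      (nth 0 d (2 * code a (rcons w c)) + 1)) by [].
apply: wp_seq; apply: wp_emit.
apply: wp_store => //=; first by lia.
rewrite subn1 /=; apply: IH => //; first exact: pwc.
  exact: stores_rcons.
move=> q c0 j0 o0 b0 bo0 d0 out; rewrite cat_rcons => desc pp sp std0.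
apply: HP => //; apply: DescendLayer desc => // c' lt_c'.
by rewrite -!Escore //; apply: best.
Qed.

Lemma members_assign p x :
  #|members (assign asg u p) x| = #|members asg x| + prefix x p.
Proof.
have fresh : u \notin members asg x by rewrite inE u_fresh.
have -> : members (assign asg u p) x
          = if prefix x p then u |: members asg x else members asg x.
  apply/setP => v; rewrite inE /assign; case: eqP => [->|/eqP/negbTE neq_vu].
    by case: ifP => _; rewrite ?setU11 ?(negbTE fresh).
  by case: ifP => _; rewrite !inE ?neq_vu.
by case: ifP => _; rewrite ?cardsU1 ?fresh addnC.
Qed.

(** The weights already count [u] along [p]; writing its word turns this provisional count into the
    true one for the extended assignment. *)
Lemma stores_assign d p : is_path a p -> stores asg p d ->
  stores (assign asg u p) [::] (set_nth 0 d (2 * u + 1) (code a p)).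
Proof.
move=> pp [d_size d_nodes d_blocks]; split=> [|v|x xblk].
- by rewrite size_set_nth -d_size; apply/maxn_idPr; have := ltn_ord u; lia.
- rewrite nth_set_nth /= /assign.
  have -> : (2 * v + 1 == 2 * u + 1) = (v == u).
    by rewrite eqn_add2r eqn_mul2l.
  by case: eqP => // _; rewrite d_nodes.
have -> : prefix x [::] = false.
  by case: x xblk {d_blocks} => // /[!is_blockE].
by rewrite nth_set_nth /= members_assign -d_blocks // addn0; case: eqP => // E; exfalso; move: E; lia.
Qed.

Lemma assigns_final_assign p : is_path a p -> size p = size a ->
  assigns_final (assign asg u p).
Proof.
by move=> pp sp v q; rewrite /assign; case: eqP => [_ [<-] // | _ /asg_final].
Qed.

Lemma wp_arrival i w q c j o b bo d : stores asg [::] d ->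
  wp (arrival_cmd rl)
    (fun m' p => [/\ multisection_choice rl prm e a asg u p,
       is_path a p, size p = size a &
       exists i w q c j o b bo d,
         m' = memory i w q c j o b bo d /\ stores (assign asg u p) [::] d])
    (memory i w q c j o b bo d).
Proof.
move=> std; have := leaves_gt0 a_ge2 (leqnn _); rewrite leaves_size => k_gt0.
apply: wp_seq; apply: wp_store => //=; first by lia.
apply: wp_seq; apply: wp_store => //=; first by lia.
apply: wp_seq.
have := @wp_leaves_loop _ prm a u _ B a_ge2 B_nbrs _ 0 w c j o b bo d (leq0n _).
rewrite leaves0; apply.
apply: wp_seq; apply: wp_store => //=; first by lia.
apply: wp_seq.
have := @wp_layer_loop _ (size a) [::] c j o b bo d.
rewrite leaves_size code_nil; apply=> // [|q' c' j' o' b' bo' d' p desc pp sp std'].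
  exact: is_path_nil.
have [d_size _ _] := std'; have code_lt := code_ltn a_ge2 pp.
apply: wp_store.
- by rewrite /= d_size; have := ltn_ord u; lia.
- by move: code_lt => /=; lia.
rewrite cats0; split=> //; do 9![eexists]; split; last exact: stores_assign std'.
by [].
Qed.

End Arrival.

(** * The whole stream and the resource bounds *)

Definition block_addr (a w : seq nat) : nat := 8 + 2 * code a w.

Lemma stores_keeps_weights n (a : seq nat) (g : assignment n) i w q c j o b bo d :
  all (leq 2) a -> stores a g [::] d ->
  keeps_weights a (block_addr a) g (memory i w q c j o b bo d).
Proof.
move=> a_ge2 [d_size _ d_blocks] x xblk.
have : is_path a x by move: xblk; rewrite is_blockE => /andP[].
move=> /(code_ltn a_ge2) code_lt; split; first by rewrite /block_addr /= d_size; lia.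
rewrite -[LHS]/(nth 0 d (2 * code a x)) d_blocks //.
by case: x xblk {code_lt d_blocks} => [/[!is_blockE]//|y x _]; rewrite addn0.
Qed.

(** Induction on the stream with arbitrary register contents, since arrivals leave them behind;
    distinctness of the streamed nodes keeps the remaining ones unassigned. *)
Lemma processes_multisection (R : realType) (rl : rule) (prm : params R) (n : nat)
    (e : rel 'I_n) (a : seq nat) (B : nat) (stream : seq ('I_n * seq 'I_n))
    (g : assignment n) i w q c j o b bo d :
  all (leq 2) a -> 2 * num_blocks a + n < B ->
  uniq [seq x.1 | x <- stream] ->
  (forall x, x \in stream -> uniq x.2 /\ x.2 =i [pred v | e x.1 v]) ->
  (forall x, x \in stream -> g x.1 = None) ->
  assigns_final a g -> stores a g [::] d ->
  processes rl prm e a (multisection_program rl) (block_addr a) B g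
    (memory i w q c j o b bo d) stream.
Proof.
move=> a_ge2 B_large.
elim: stream g i w q c j o b bo d => //= -[u N] stream IH g i w q c j o b bo d.
rewrite -[(u, N).1]/u => /andP[u_notin uniq_s] nbrs fresh g_final std.
have /= [N_uniq N_nbrs] := nbrs _ (mem_head _ _).
have /= u_fresh := fresh _ (mem_head _ _).
have [m' [p [E [choice pp sp [i' [w' [q' [c' [j' [o' [b' [bo' [d' [Em' std']]]]]]]]]]]]]]
  := wp_arrival rl prm a_ge2 N_uniq N_nbrs B_large g_final u_fresh i w q c j o b bo std.
exists m', p; split=> //; rewrite Em'; first exact: stores_keeps_weights.
apply: IH => // [x xs | x xs |].
- by apply: nbrs; rewrite inE xs orbT.
- rewrite /assign; case: eqP => [Eu|_]; last by apply: fresh; rewrite inE xs orbT.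
  by case/negP: u_notin; rewrite -Eu map_f.
- exact: assigns_final_assign.
Qed.

(* Memory is counted in words of O(log (n + k)) bits, i.e. holding numbers
   below (n + k) ^ D. The program, the layout of the block weights and the
   constants C and D do not depend on the graph, the hierarchy, the parameters
   of the scoring rule or the stream. *)
Theorem theorem1 (rl : rule) :
  exists (P : program) (addr : seq nat -> seq nat -> nat) (C D : nat),
  forall (R : realType) (n : nat) (e : rel 'I_n) (a : seq nat)
         (prm : params R) (stream : seq ('I_n * seq 'I_n)),
    symmetric e -> irreflexive e ->
    0 < size a -> all (leq 2) a ->
    (forall i, 1 <= i <= size a -> (0 < cap prm i)%R) ->
    is_stream e stream ->
    {in is_block a &, injective (addr a)} /\
    exists s : nat,
      total_memory a s stream <= C * (n + num_blocks a) /\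
      implements rl prm e a P (addr a) ((n + num_blocks a) ^ D) s stream.

Proof.
(* Since [size a < k], the total is at most 7k + 3n + 7, so 20 is generous. The exponent 3 gives the
   strict bound 2k + n < B; a square would fail at n = 0, k = 2. *)
exists (multisection_program rl), block_addr, 20, 3.
move=> R n e a prm stream _ _ a_gt0 a_ge2 _ [perm_s nbrs]; split.
  move=> w v wblk vblk /eqP; rewrite /block_addr eqn_add2l eqn_mul2l /= => /eqP.
  by apply: (code_inj a_ge2); [move: wblk | move: vblk];
    rewrite /in_mem /= is_blockE => /andP[].
have k_gt : size a < num_blocks a by rewrite -leaves_size; apply: ltn_leaves.
(* Eight registers; weights use even offsets below 4k, nodes use odd offsets below 2n, so 4k + 2n
   words hold both. *)
exists (8 + (4 * num_blocks a + 2 * n)); split.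
  rewrite /total_memory.
  have : \max_(x <- stream) (size x.2).+1 <= n.+1.
    apply/bigmax_leqP_seq => x /nbrs[x_uniq _] _; rewrite ltnS.
    by rewrite -(card_uniqP x_uniq) -[X in _ <= X]card_ord max_card.
  by lia.
have B_large : 2 * num_blocks a + n < (n + num_blocks a) ^ 3.
  have : (n + num_blocks a) * 2 ^ 2 <= (n + num_blocks a) ^ 3.
    by rewrite [X in _ <= X]expnS leq_mul2l leq_exp2r //; lia.
  by lia.
(* Zeroed memory already represents the empty assignment, which is why the setup is [Skip]. *)
have std : stores a (@unassigned n) [::] (nseq (4 * num_blocks a + 2 * n) 0).
  split=> [|v|x xblk]; rewrite ?size_nseq // nth_nseq if_same //.
  have -> : members (@unassigned n) x = set0 by apply/setP => v; rewrite !inE.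
  by rewrite cards0; case: x xblk => // /[!is_blockE].
exists (nseq (8 + (4 * num_blocks a + 2 * n)) 0).
rewrite -[nseq _ _]/(memory 0 0 0 0 0 0 0 0 (nseq (4 * num_blocks a + 2 * n) 0)).
split; first by constructor.
- exact: stores_keeps_weights.
- apply: processes_multisection => //.
  by rewrite (perm_uniq perm_s) enum_uniq.
Qed.
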